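(* Let $S$ and $S'$ be tight scripts in which every point $p$ satisfies $\partial p=1$. Then the extended cubic Cartesian product $S''$ of $S$ and $S'$ is also tight.
   Context: Scripts. A script is a chain complex of free $\mathbb{Z}$-modules $0\leftarrow \mathcal{M}_{-1}=\mathbb{Z}\xleftarrow{\partial}\mathcal{M}_0\xleftarrow{\partial}\mathcal{M}_1\xleftarrow{\partial}\cdots$ with $\partial\circ\partial=0$, where for $k\ge 0$ the module $\mathcal{M}_k$ is the free $\mathbb{Z}$-module on a given set $\mathcal{C}_k$, whose elements are called $k$-cells (points for $k=0$, lines for $k=1$). The generator $1$ of $\mathcal{M}_{-1}$ is called the accumulator, and we put $\mathcal{C}_{-1}=\{1\}$ and $\mathcal{M}_{-2}=0$. Elements of $\mathcal{M}_k$ are $k$-chains. The support of a chain is the set of cells occurring in it with nonzero coefficient, and $\mathrm{b}(C):=\operatorname{supp}(\partial C)$. Tightness. For $\mathcal{U}\subset\mathcal{C}_k$, $\mathcal{Z}_k(\mathcal{U})$ denotes the module of $k$-chains $C$ with $\operatorname{supp} C\subset\mathcal{U}$ and $\partial C=0$. A $k$-cell $C$ ($k\ge 0$) is tight if $\partial C\neq 0$ and the $\mathbb{Z}$-module $\mathcal{Z}_{k-1}(\mathrm{b}(C))$ is generated by the single element $\partial C$. A script is tight if each of its cells is tight. Extended cubic Cartesian product. Let $S,S'$ be scripts with cell sets $\mathcal{C}_k,\mathcal{C}'_k$ ($k\ge0$). For $k\ge 0$ put $\mathcal{C}''_k=\bigcup_{s=0}^k\mathcal{C}_s\times\mathcal{C}'_{k-s}$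 and let $\mathcal{M}''_k$ be the free $\mathbb{Z}$-module on $\mathcal{C}''_k$; extend the symbol $(C,C')$ bilinearly to chains. For $(C,C')\in\mathcal{C}_s\times\mathcal{C}'_{k-s}$ with $k\ge1$ define $$\partial(C,C')=(\partial C,C')+(-1)^s(C,\partial C'),$$ where here the boundary of a point of $S$ or of $S'$ is taken to be $0$ (i.e. the boundary operators of the truncated complexes $0\leftarrow\mathcal{M}_0\leftarrow\mathcal{M}_1\leftarrow\cdots$ are used). Finally put $\mathcal{M}''_{-1}=\mathbb{Z}$ and $\partial(p,q)=1$ for all $(p,q)\in\mathcal{C}''_0=\mathcal{C}_0\times\mathcal{C}'_0$. The resulting sequence $S'':0\leftarrow\mathbb{Z}\leftarrow\mathcal{M}''_0\leftarrow\mathcal{M}''_1\leftarrow\cdots$ is the extended cubic Cartesian product. *)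

(* Defs.v *)
From HB Require Import structures.
From mathcomp Require Import all_boot all_order all_algebra.
From mathcomp.multinomials Require Export freeg.

Set Implicit Arguments.
Unset Strict Implicit.
Unset Printing Implicit Defensive.

Import GRing.Theory.

Local Open Scope ring_scope.

(* Degrees are shifted by one: [gens C n] is the set of cells, and           *)
(* [chains C n] the module of chains, of degree n - 1.  So the index 0       *)
(* stands for degree -1: M_{-1} = Z, with the accumulator [tt] as generator. *)
Definition gens (C : nat -> choiceType) (n : nat) : choiceType :=
  if n is k.+1 then C k else unit.

Definition chains (C : nat -> choiceType) (n : nat) : zmodType :=
  if n is k.+1 then {freeg (C k) / int} else int.

Definition supp (C : nat -> choiceType) (n : nat) :
    chains C n -> pred (gens C n) :=
  match n with
  | 0 => fun z _ => z != 0
  | k.+1 => fun c x => x \in dom c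
  end.

(* [bd k] goes from M_k to M_{k-1}. *)
Record chain_seq := ChainSeq {
  cell : nat -> choiceType;
  bd : forall k, {additive chains cell k.+1 -> chains cell k} }.

Definition is_script (S : chain_seq) : Prop :=
  forall k (c : chains (cell S) k.+2), bd S k (bd S k.+1 c) = 0.

(* Every element of M_{-1} is closed, since M_{-2} = 0. *)
Definition closed_chain (S : chain_seq) (n : nat) : chains (cell S) n -> Prop :=
  match n with
  | 0 => fun _ => True
  | k.+1 => fun c => bd S k c = 0
  end.

Definition cycles_in (S : chain_seq) (n : nat) (U : pred (gens (cell S) n))
    (Z : chains (cell S) n) : Prop :=
  {subset supp Z <= U} /\ closed_chain Z.

Definition cell_bd (S : chain_seq) (k : nat) (c : cell S k) :
    chains (cell S) k :=
  bd S k (<< c >> : {freeg (cell S k) / int}).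

Definition tight_cell (S : chain_seq) (k : nat) (c : cell S k) : Prop :=
  cell_bd c <> 0 /\
  forall Z : chains (cell S) k,
    cycles_in (supp (cell_bd c)) Z <-> exists n : int, Z = cell_bd c *~ n.

Definition tight_script (S : chain_seq) : Prop :=
  is_script S /\ forall k (c : cell S k), tight_cell c.

Section CubicProduct.
Variables S S' : chain_seq.

(* The union over s + t = k of C_s * C'_t is taken over the pairs (s, t),    *)
(* rather than over s with t := k - s, so as to avoid type casts.            *)
Definition pcell (k : nat) : choiceType :=
  {st : {st : nat * nat | (st.1 + st.2 == k)%N} &
     (cell S (val st).1 * cell S' (val st).2)%type}.

Definition pair_cell (k s t : nat) (e : (s + t == k)%N)
    (c : cell S s) (c' : cell S' t) : pcell k :=
  existT (fun st : {st : nat * nat | (st.1 + st.2 == k)%N} =>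
            (cell S (val st).1 * cell S' (val st).2)%type)
    (exist (fun st : nat * nat => (st.1 + st.2 == k)%N) (s, t) e) (c, c').

Definition pair_chain (k s t : nat) (e : (s + t == k)%N)
    (A : {freeg (cell S s) / int}) (B : {freeg (cell S' t) / int}) :
    {freeg (pcell k) / int} :=
  fglift (fun c => fglift (fun c' => << pair_cell e c c' >>) B) A.

(* The terms (∂C, C') and (C, ∂C'), with truncated boundaries. *)
Definition bd_left (k s t : nat) :
    (s + t == k.+1)%N -> cell S s -> cell S' t -> {freeg (pcell k) / int} :=
  match s with
  | 0 => fun _ _ _ => 0
  | s'.+1 => fun (e : (s' + t == k)%N) c c' =>
      pair_chain e (cell_bd c) << c' >>
  end.

Lemma addnS_eq (k s t : nat) : (s + t.+1 == k.+1)%N -> (s + t == k)%N.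
Proof. by rewrite addnS eqSS. Qed.

Definition bd_right (k s t : nat) :
    (s + t == k.+1)%N -> cell S s -> cell S' t -> {freeg (pcell k) / int} :=
  match t with
  | 0 => fun _ _ _ => 0
  | t'.+1 => fun e c c' =>
      pair_chain (addnS_eq e) << c >> (cell_bd c')
  end.

Definition pcell_bd (k : nat) (x : pcell k.+1) : {freeg (pcell k) / int} :=
  let: existT (exist st e) (c, c') := x in
  bd_left e c c' + (-1) ^+ st.1 *: bd_right e c c'.

HB.instance Definition _ (k : nat) :=
  GRing.isZmodMorphism.Build {freeg (pcell k.+1) / int}
    {freeg (pcell k) / int} (fglift (@pcell_bd k))
    (lift_is_additive (@pcell_bd k)).

(* [deg], the sum of the coefficients, is the extension of ∂(p, q) = 1. *)
Definition pbd (k : nat) : {additive chains pcell k.+1 -> chains pcell k} :=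
  match k with
  | 0 => deg (K := pcell 0)
  | k'.+1 => fglift (@pcell_bd k')
  end.

Definition cubic_product : chain_seq := ChainSeq pbd.

End CubicProduct.

(* Main.v *)
(* A cycle Z supported by the boundary of a product cell (c, c') has the form *)
(* (A, c') + (c, B), with A and B supported by the boundaries of c and c'.    *)
(* When both cells have positive dimension, the component of dZ = 0 along the *)
(* products of faces of c by faces of c' says that A (x) dc' = +- dc (x) B.   *)
(* Taking the coefficient of a cell that occurs in dc' gives dA = 0, since    *)
(* chains are torsion-free; hence A = n dc by tightness of c, and the same    *)
(* equation then determines B.  The component (dA, c') cannot be used for     *)
(* this: the truncated boundary kills it when c is a line.                    *)
(* If one of the cells is a point, dp = 1 on points makes the sum of          *)
(* coefficients on the product agree with the boundary on the other factor.   *)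

Require Import Defs.
From HB Require Import structures.
From mathcomp Require Import all_boot all_order all_algebra.
From mathcomp Require Import ring.
Local Open Scope ring_scope.

Set Implicit Arguments.
Unset Strict Implicit.
Unset Printing Implicit Defensive.

Import GRing.Theory.

(** Product chains of degree k split into blocks indexed by (s, t) with s + t = k, and [pair_chain]
    is the tensor product into one block: by [coeff_pair_chain] its coefficients form a matrix of
    rank at most one. For two cells of positive dimension ([tight_pair_cell]), reading dZ = 0
    through [coeff_pbd_left] and [coeff_pbd_right] makes A rationally proportional to dc; tightness
    of c makes the ratio an integer n, and cancelling a coefficient of dc makes B the matching
    multiple of dc'. If one factor is a point, a single slice remains and tightness of the other
    factor suffices ([tight_pair_cell0], [tight_pair_0cell]); in the lowest degree this rests on the
    multiplicativity of the augmentation, [pbd0_pair_chain]. *)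

Lemma zmod_morphism0 (U V : zmodType) (f : U -> V) : zmod_morphism f -> f 0 = 0.
Proof. by move=> fB; rewrite -[in LHS](subrr 0) fB subrr. Qed.

Lemma zmod_morphismMz (U V : zmodType) (f : U -> V) (n : int) :
  zmod_morphism f -> {morph f : x / x *~ n}.
Proof.
move=> fB x; pose F : {additive U -> V} :=
  HB.pack f (GRing.isZmodMorphism.Build _ _ f fB).
exact: (raddfMz F).
Qed.

(** * Coefficients and additive maps on free abelian groups *)

Section FreeGroup.
Variable K : choiceType.
Implicit Types A B : {freeg K / int}.

Lemma coeff_inj A B : (forall x, coeff x A = coeff x B) -> A = B.
Proof. by move=> eqAB; apply/eqP/freeg_eqP. Qed.

Lemma coeffMz x A (n : int) : coeff x (A *~ n) = coeff x A * n.
Proof. by rewrite raddfMz /= mulrzz. Qed.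

Lemma neq0_coeff A : A <> 0 -> exists x, coeff x A != 0.
Proof.
move=> /eqP; rewrite -dom_eq0; case domA: (dom A) => [|x r] // _.
by exists x; rewrite -mem_dom domA mem_head.
Qed.

Lemma scale_freeg (n : int) A : n *: A = A *~ n.
Proof. by rewrite -scaler_int intz. Qed.

(** Uniqueness in the universal property. The predicate [zmod_morphism] replaces bundled maps so
    that partial applications of [pair_chain] qualify. *)
Lemma zmod_morphism_freegP (V : zmodType) (f g : {freeg K / int} -> V) :
    zmod_morphism f -> zmod_morphism g ->
  (forall x, f << x >> = g << x >>) -> f =1 g.
Proof.
move=> fB gB eqfg A.
pose F : {additive {freeg K / int} -> V} :=
  HB.pack f (GRing.isZmodMorphism.Build _ _ f fB).
pose G : {additive {freeg K / int} -> V} :=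
  HB.pack g (GRing.isZmodMorphism.Build _ _ g gB).
change (F A = G A); rewrite -[A]freeg_sumE !raddf_sum.
apply: eq_bigr => x _.
have -> : << coeff x A *g x >> = << x >> *~ coeff x A.
  by rewrite freegU_mulz intz.
by rewrite !raddfMz; congr (_ *~ _); apply: eqfg.
Qed.

Lemma fgliftE (V : lmodType int) (f : K -> V) A :
  fglift f A = \sum_(x <- dom A) coeff x A *: f x.
Proof.
pose F : {additive {freeg K / int} -> V} :=
  HB.pack (fglift f)
    (GRing.isZmodMorphism.Build _ _ (fglift f) (lift_is_additive f)).
rewrite -[LHS]/(F A) -{1}[A]freeg_sumE raddf_sum.
by apply: eq_bigr => x _; rewrite /F /= liftU.
Qed.

(** Restricts a chain to a slice of the product; the list [r] bounds the support, so the defining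
    sum is finite. *)
Lemma freeg_fiber (L : choiceType) (f : L -> K) A (r : seq L) :
    (forall x, x \notin r -> coeff (f x) A = 0) ->
  exists B : {freeg L / int}, forall x, coeff x B = coeff (f x) A.
Proof.
move=> fA; exists (\sum_(y <- undup r) << coeff (f y) A *g y >>) => x.
rewrite raddf_sum /=; have [xr|xr] := boolP (x \in r).
  rewrite (bigD1_seq x) ?mem_undup ?undup_uniq //=.
  rewrite coeffU eqxx mulr1 big1 ?addr0 //.
  by move=> y /negPf yx; rewrite coeffU yx mulr0.
rewrite fA // big_seq big1 // => y; rewrite mem_undup coeffU => yr.
by case: eqP yr => [->|]; rewrite ?(negPf xr) ?mulr0.
Qed.

End FreeGroup.

(** * Product chains as tensors, and their boundaries *)

Section PairChains.
Variables S S' : chain_seq.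
Implicit Types k s t : nat.

Lemma pcellP k (x : pcell S S' k) :
  exists s t (e : (s + t == k)%N) c c', x = pair_cell e c c'.
Proof. by case: x => [[[s t] e] [c c']]; exists s, t, e, c, c'. Qed.

Lemma pair_cell_eq k s t (e e' : (s + t == k)%N)
    (a c : cell S s) (a' c' : cell S' t) :
  (pair_cell e a a' == pair_cell e' c c') = (a == c) && (a' == c').
Proof. by rewrite (eq_irrelevance e' e) /pair_cell eq_Tagged. Qed.

Lemma pair_cell_neq k s t s1 t1 (e : (s + t == k)%N) (e1 : (s1 + t1 == k)%N)
    (c : cell S s) (c' : cell S' t) (a : cell S s1) (a' : cell S' t1) :
  s1 != s -> (pair_cell e1 a a' == pair_cell e c c') = false.
Proof.
by move=> /eqP ne; apply/eqP => /(congr1 (fun x => (val (tag x)).1)).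
Qed.

Lemma pair_chainU k s t (e : (s + t == k)%N) (c : cell S s) (c' : cell S' t) :
  pair_chain e << c >> << c' >> = << pair_cell e c c' >>.
Proof. by rewrite /pair_chain liftU scale1r liftU scale1r. Qed.

Lemma coeff_pair_chain k s t (e e' : (s + t == k)%N)
    (c : cell S s) (c' : cell S' t) A B :
  coeff (pair_cell e c c') (pair_chain e' A B) = coeff c A * coeff c' B.
Proof.
rewrite /pair_chain -{2}[A]freeg_sumE fgliftE !raddf_sum mulr_suml.
apply: eq_bigr => a _; rewrite /= coeffZ -{2}[B]freeg_sumE fgliftE !raddf_sum.
rewrite !mulr_sumr; apply: eq_bigr => b _.
rewrite /= coeffZ !coeffU pair_cell_eq mul1r.
by rewrite -mulnb natrM mulrACA mulrA.
Qed.

Lemma coeff_pair_chain_neq k s t s1 t1 (e : (s + t == k)%N)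
    (e1 : (s1 + t1 == k)%N) (c : cell S s) (c' : cell S' t)
    (A : {freeg (cell S s1) / int}) (B : {freeg (cell S' t1) / int}) :
  s1 != s -> coeff (pair_cell e c c') (pair_chain e1 A B) = 0.
Proof.
move=> ne; rewrite /pair_chain fgliftE raddf_sum big1 // => a _.
rewrite /= coeffZ fgliftE raddf_sum big1 ?mulr0 // => b _.
by rewrite /= coeffZ coeffU pair_cell_neq // !mulr0.
Qed.

Lemma pair_chain_eq0l k s t (e : (s + t == k)%N) A (c' : cell S' t) :
  pair_chain e A << c' >> = 0 -> A = 0 :> {freeg (cell S s) / int}.
Proof.
move=> A0; apply: coeff_inj => a; rewrite coeff0.
by rewrite -[RHS](coeff0 _ (pair_cell e a c')) -A0 coeff_pair_chain coeffU
  eqxx !mulr1.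
Qed.

Lemma pair_chain_eq0r k s t (e : (s + t == k)%N) (c : cell S s) B :
  pair_chain e << c >> B = 0 -> B = 0 :> {freeg (cell S' t) / int}.
Proof.
move=> B0; apply: coeff_inj => b; rewrite coeff0.
by rewrite -[RHS](coeff0 _ (pair_cell e c b)) -B0 coeff_pair_chain coeffU
  eqxx !mul1r.
Qed.

(** Allows coefficientwise comparison block by block: a cell outside block (s, t) is invisible to
    every tensor in that block. *)
Lemma pcell_dimP k s t (e : (s + t == k)%N) (x : pcell S S' k) :
  (exists c c', x = pair_cell e c c') \/
  (forall A B, coeff x (pair_chain e A B) = 0).
Proof.
have [s1 [t1 [e1 [c [c' ->]]]]] := pcellP x.
have [eqs|ne] := eqVneq s s1; last first.
  by right=> A B; rewrite coeff_pair_chain_neq.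
subst s1; have eqt : t1 = t by apply/(@addnI s)/eqP; rewrite (eqP e) (eqP e1).
by subst t1; left; exists c, c'; rewrite (eq_irrelevance e1 e).
Qed.

Lemma pair_chainBl k s t (e : (s + t == k)%N) B :
  zmod_morphism (fun A => pair_chain (S := S) (S' := S') e A B).
Proof. exact: lift_is_additive. Qed.

Lemma pair_chainBr k s t (e : (s + t == k)%N) A :
  zmod_morphism (fun B => pair_chain (S := S) (S' := S') e A B).
Proof.
move=> B1 B2; apply: coeff_inj => x; rewrite coeffB.
have [[c [c' ->]]|x0] := pcell_dimP e x; last by rewrite !x0 subr0.
by rewrite !coeff_pair_chain coeffB mulrBr.
Qed.

(** Bilinear extension: an identity between biadditive expressions need only be checked on pairs of
    cells. The boundary formulas below all follow this way. *)
Lemma pair_chain_rect k s t (e : (s + t == k)%N) (V : zmodType)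
    (f : {freeg (pcell S S' k) / int} -> V) g A B :
    zmod_morphism f -> (forall B, zmod_morphism (g^~ B)) ->
    (forall A, zmod_morphism (g A)) ->
    (forall c c', f << pair_cell e c c' >> = g << c >> << c' >>) ->
  f (pair_chain e A B) = g A B.
Proof.
move=> fB glB grB eqfg.
apply: (zmod_morphism_freegP (f := fun A => f (pair_chain e A B)) (g := g^~ B)).
- by move=> A1 A2; rewrite pair_chainBl fB.
- exact: glB.
move=> c; apply: (zmod_morphism_freegP
  (f := fun B => f (pair_chain e << c >> B)) (g := g << c >>)).
- by move=> B1 B2; rewrite pair_chainBr fB.
- exact: grB.
by move=> c'; rewrite pair_chainU.
Qed.

Local Notation bdS k A := (bd S k (A : {freeg (cell S k) / int})).
Local Notation bdS' k A := (bd S' k (A : {freeg (cell S' k) / int})).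

Lemma deg_pair_chain (e : (0 + 0 == 0)%N) A B :
  deg (pair_chain (S := S) (S' := S') e A B) = deg A * deg B.
Proof.
apply: (pair_chain_rect (g := fun A B => deg A * deg B)).
- exact: raddfB.
- by move=> ? ? ?; rewrite raddfB mulrBl.
- by move=> ? ? ?; rewrite raddfB mulrBr.
by move=> c c'; rewrite !degU mulr1.
Qed.

Lemma pbd_pair_chain0 k s (e : (s.+1 + 0 == k.+1)%N) A B :
  pbd S S' k.+1 (pair_chain e A B) =
  pair_chain (e : (s + 0 == k)%N) (bdS s.+1 A) B.
Proof.
apply: (pair_chain_rect (f := pbd S S' k.+1)
  (g := fun A B => pair_chain (e : (s + 0 == k)%N) (bdS s.+1 A) B)).
- exact: raddfB.
- by move=> ? ? ?; rewrite raddfB pair_chainBl.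
- by move=> ? ? ?; rewrite pair_chainBr.
by move=> c c'; rewrite /= liftU scale1r /= scaler0 addr0.
Qed.

Lemma pbd_pair_0chain k t (e : (0 + t.+1 == k.+1)%N) A B :
  pbd S S' k.+1 (pair_chain e A B) =
  pair_chain (e : (0 + t == k)%N) A (bdS' t.+1 B).
Proof.
apply: (pair_chain_rect (f := pbd S S' k.+1)
  (g := fun A B => pair_chain (e : (0 + t == k)%N) A (bdS' t.+1 B))).
- exact: raddfB.
- by move=> ? ? ?; rewrite pair_chainBl.
- by move=> ? ? ?; rewrite raddfB pair_chainBr.
move=> c c'; rewrite /= liftU scale1r /= add0r scale1r.
by congr (pair_chain _ _ _); apply: eq_irrelevance.
Qed.

Lemma pbd_pair_chain k s t (e : (s.+1 + t.+1 == k.+1)%N) A B :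
  pbd S S' k.+1 (pair_chain e A B) =
  pair_chain (e : (s + t.+1 == k)%N) (bdS s.+1 A) B
  + (-1) ^+ s.+1 *: pair_chain (addnS_eq e) A (bdS' t.+1 B).
Proof.
apply: (pair_chain_rect (f := pbd S S' k.+1)
  (g := fun A B => pair_chain (e : (s + t.+1 == k)%N) (bdS s.+1 A) B
    + (-1) ^+ s.+1 *: pair_chain (addnS_eq e) A (bdS' t.+1 B))).
- exact: raddfB.
- by move=> ? ? ?; rewrite raddfB !pair_chainBl scalerBr opprD addrACA.
- by move=> ? ? ?; rewrite raddfB !pair_chainBr scalerBr opprD addrACA.
by move=> c c'; rewrite /= liftU scale1r.
Qed.

(** The left term is (dA, B) for s > 0 and is absent by truncation for s = 0, so one formula covers
    both cases. *)
Lemma pbd_cycle_chain k s t (e : (s + t.+1 == k.+1)%N) A B :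
  bdS s A = 0 ->
  pbd S S' k.+1 (pair_chain e A B) =
  (-1) ^+ s *: pair_chain (addnS_eq e) A (bdS' t.+1 B).
Proof.
case: s e A => [|s] e A A0.
  by rewrite pbd_pair_0chain scale1r (eq_irrelevance (addnS_eq e) e).
by rewrite pbd_pair_chain A0 (zmod_morphism0 (pair_chainBl _ _)) add0r.
Qed.

Lemma pbd_chain_cycle k s t (e : (s.+1 + t == k.+1)%N) A B :
  bdS' t B = 0 ->
  pbd S S' k.+1 (pair_chain e A B) =
  pair_chain (e : (s + t == k)%N) (bdS s.+1 A) B.
Proof.
case: t e B => [|t] e B B0; first by rewrite pbd_pair_chain0.
by rewrite pbd_pair_chain B0 (zmod_morphism0 (pair_chainBr _ _)) scaler0 addr0.
Qed.

(** The other summand of the boundary has first degree s + 1, hence lies in a different block. *)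
Lemma coeff_pbd_left k s t (e : (s.+1 + t == k.+1)%N) (e' : (s + t == k)%N)
    A B a b :
  coeff (pair_cell e' a b) (pbd S S' k.+1 (pair_chain e A B)) =
  coeff a (bdS s.+1 A) * coeff b B.
Proof.
case: t e e' B b => [|t] e e' B b.
  by rewrite pbd_pair_chain0 coeff_pair_chain.
rewrite pbd_pair_chain coeffD coeffZ coeff_pair_chain.
by rewrite coeff_pair_chain_neq ?mulr0 ?addr0 // neq_ltn ltnSn orbT.
Qed.

Lemma coeff_pbd_right k s t (e : (s + t.+1 == k.+1)%N) (e' : (s + t == k)%N)
    A B a b :
  coeff (pair_cell e' a b) (pbd S S' k.+1 (pair_chain e A B)) =
  (-1) ^+ s * (coeff a A * coeff b (bdS' t.+1 B)).
Proof.
case: s e e' A a => [|s] e e' A a.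
  by rewrite pbd_pair_0chain mul1r coeff_pair_chain.
rewrite pbd_pair_chain coeffD coeffZ coeff_pair_chain.
by rewrite coeff_pair_chain_neq ?add0r // neq_ltn ltnSn.
Qed.

End PairChains.

(** * Tightness in terms of coefficients *)

Lemma bd0_deg (S : chain_seq) (A : {freeg (cell S 0) / int}) :
  (forall p : cell S 0, cell_bd p = 1 :> int) -> bd S 0 A = deg A.
Proof.
move=> pS; apply: (zmod_morphism_freegP (f := bd S 0)) => [||p].
- exact: raddfB.
- exact: raddfB.
by rewrite degU; apply: pS.
Qed.

Lemma mem_supp (C : nat -> choiceType) k (A : {freeg (C k) / int}) (x : C k) :
  ((x : gens C k.+1) \in supp (A : chains C k.+1)) = (coeff x A != 0).
Proof. exact: mem_dom. Qed.

(** The easy half of tightness, valid in any script. *)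
Lemma cycles_in_mulz (S : chain_seq) k (c : cell S k) (n : int) :
  is_script S -> cycles_in (supp (cell_bd c)) (cell_bd c *~ n).
Proof.
case: k c => [|k] c scS; split=> //=.
- move=> x; rewrite /in_mem /=; apply: contraNN => /eqP ->.
  by rewrite mul0rz.
- move=> x; rewrite !mem_supp coeffMz mulf_eq0 negb_or.
  by case/andP.
- by rewrite raddfMz scS mul0rz.
Qed.

Lemma tight_cell_gen (S : chain_seq) k (c : cell S k.+1) A :
    tight_cell c -> bd S k A = 0 ->
    (forall a, coeff a (cell_bd c : {freeg (cell S k) / int}) = 0 ->
               coeff a (A : {freeg (cell S k) / int}) = 0) ->
  exists n : int, A = cell_bd c *~ n.
Proof.
move=> [_ cyc] A0 suppA; apply/cyc; split=> // a.
by rewrite !mem_supp; apply: contra_neq; apply: suppA.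
Qed.

Lemma chains_mulz_eq0 (C : nat -> choiceType) k (A : chains C k) (n : int) :
  n != 0 -> A *~ n = 0 -> A = 0.
Proof.
case: k A => [|k] A n0.
  by rewrite mulrzz => /eqP; rewrite mulf_eq0 (negPf n0) orbF => /eqP.
move=> An0; apply: (@coeff_inj (C k)) => x; apply/eqP; rewrite coeff0.
have /eqP := coeffMz x A n; rewrite An0 coeff0 eq_sym mulf_eq0 (negPf n0).
by rewrite orbF.
Qed.

(** * Tightness of the product, by the dimensions of the two factors *)

Section Product.
Variables S S' : chain_seq.
Hypotheses (tS : tight_script S) (tS' : tight_script S').
Hypothesis pS : forall p : cell S 0, cell_bd p = 1 :> int.
Hypothesis pS' : forall p : cell S' 0, cell_bd p = 1 :> int.

Lemma pbd0_pair_chain (e : (0 + 0 == 0)%N) A B :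
  pbd S S' 0 (pair_chain e A B) = bd S 0 A * bd S' 0 B.
Proof. by rewrite !bd0_deg // -deg_pair_chain. Qed.

Lemma cell_bdE k s t (e : (s + t == k)%N) c c' :
  cell_bd (S := cubic_product S S') (pair_cell e c c') =
  pbd S S' k (pair_chain e << c >> << c' >>).
Proof. by rewrite pair_chainU. Qed.

(** With a point as one factor, this is dd = 0 in the other. Otherwise the two mixed terms (dc, dc')
    carry the signs (-1)^s and (-1)^(s+1) and cancel. *)
Lemma is_script_cubic_product : is_script (cubic_product S S').
Proof.
move=> k; apply: (zmod_morphism_freegP
  (f := fun x => pbd S S' k (pbd S S' k.+1 x)) (g := fun=> 0)).
- by move=> x y; rewrite !raddfB.
- by move=> x y; rewrite subr0.
move=> x; have [s [t [e [c [c' ->]]]]] := pcellP x.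
rewrite -pair_chainU.
case: s e c => [|s] e c; case: t e c' => [|t] e c' //.
- rewrite pbd_pair_0chain; case: k x e => [|k] x e.
    (* A line times a point: the outer boundary is the augmentation, not the cubic formula. *)
    have ? : t = 0%N by apply/eqP.
    by subst t; rewrite pbd0_pair_chain tS'.1 mulr0.
  case: t e c' => [|t] e c' //.
  by rewrite pbd_pair_0chain tS'.1 (zmod_morphism0 (pair_chainBr _ _)).
- rewrite pbd_pair_chain0; case: k x e => [|k] x e.
    have ? : s = 0%N by apply/eqP; rewrite -(addn0 s).
    by subst s; rewrite pbd0_pair_chain tS.1 mul0r.
  case: s e c => [|s] e c //.
  by rewrite pbd_pair_chain0 tS.1 (zmod_morphism0 (pair_chainBl _ _)).
case: k x e => [|k] x e; first by exfalso; move: e; rewrite addSn addnS.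
rewrite pbd_pair_chain raddfD scale_freeg raddfMz -scale_freeg.
rewrite pbd_cycle_chain ?tS.1 // pbd_chain_cycle ?tS'.1 //.
rewrite exprS mulN1r scaleNr; apply/eqP; rewrite subr_eq0; apply/eqP.
by congr (_ *: pair_chain _ _ _); apply: eq_irrelevance.
Qed.

(** In positive degree, pairing with c' is injective. In degree 0 the augmentation of (A, c') is dA
    times dc', and dc' = 1. *)
Lemma closed_pair_chain0 k s (e : (s + 0 == k)%N) A (c' : cell S' 0) :
  closed_chain (S := cubic_product S S') (n := k.+1)
    (pair_chain e A << c' >>) ->
  bd S s A = 0.
Proof.
case: k e => [|k] e cycA.
  have ? : s = 0%N by apply/eqP; rewrite -(addn0 s).
  subst s; have := pbd0_pair_chain e A << c' >>.
  by rewrite [bd S' 0 _]pS' mulr1 => <-.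
case: s e A cycA => [|s] e A cycA //.
by apply: (@pair_chain_eq0l _ _ k s 0 e _ c'); rewrite -pbd_pair_chain0.
Qed.

Lemma closed_pair_0chain k t (e : (0 + t == k)%N) (c : cell S 0) B :
  closed_chain (S := cubic_product S S') (n := k.+1)
    (pair_chain e << c >> B) ->
  bd S' t B = 0.
Proof.
case: k e => [|k] e cycB.
  have ? : t = 0%N by apply/eqP.
  subst t; have := pbd0_pair_chain e << c >> B.
  by rewrite [bd S 0 _]pS mul1r => <-.
case: t e B cycB => [|t] e B cycB //.
by apply: (@pair_chain_eq0r _ _ k 0 t e c); rewrite -pbd_pair_0chain.
Qed.

Lemma tight_product_cell k (x : pcell S S' k.+1)
    (T : {freeg (pcell S S' k) / int}) :
    cell_bd (S := cubic_product S S') x = T -> T <> 0 ->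
    (forall Z : {freeg (pcell S S' k) / int},
       closed_chain (S := cubic_product S S') (n := k.+1) Z ->
       (forall y, coeff y T = 0 -> coeff y Z = 0) ->
     exists n : int, Z = T *~ n) ->
  tight_cell (S := cubic_product S S') x.
Proof.
move=> xT T0 genT; split; first by rewrite xT.
move=> Z; split=> [[suppZ cycZ]|[n ->]]; last first.
  exact: (cycles_in_mulz _ _ is_script_cubic_product).
rewrite xT; apply: genT => // y.
by apply: contra_eq; have := suppZ y; rewrite !mem_supp xT.
Qed.

(** The boundary of (c, c') lies in the slice over the point c', so Z = (A, c') and tightness of c
    applies to A. *)
Lemma tight_pair_cell0 k s (e : (s.+1 + 0 == k.+1)%N) c c' :
  tight_cell (S := cubic_product S S') (pair_cell e c c').
Proof.
pose e0 : (s + 0 == k)%N := e.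
apply: (tight_product_cell (T := pair_chain e0 (cell_bd c) << c' >>)).
- by rewrite cell_bdE pbd_pair_chain0.
- by move=> /pair_chain_eq0l; case: (tS.2 _ c).
move=> Z cycZ suppZ.
have [A coefA] : exists A : {freeg (cell S s) / int},
    forall a, coeff a A = coeff (pair_cell e0 a c') Z.
  apply: (freeg_fiber (r := dom (cell_bd c : {freeg (cell S s) / int}))) => a.
  by move=> /coeff_outdom a0; apply: suppZ; rewrite coeff_pair_chain a0 mul0r.
have ZE : Z = pair_chain e0 A << c' >>.
  apply: coeff_inj => x; have [[a [b ->]]|x0] := pcell_dimP e0 x; last first.
    by rewrite suppZ !x0.
  rewrite coeff_pair_chain coefA coeffU mul1r.
  have [->|/negPf ne] := eqVneq c' b; first by rewrite mulr1.
  by rewrite mulr0 suppZ // coeff_pair_chain coeffU ne !mulr0.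
have [||n AE] := tight_cell_gen (A := A) (tS.2 _ c).
- by apply: (closed_pair_chain0 (e := e0) (c' := c')); rewrite -ZE.
- by move=> a a0; rewrite coefA suppZ // coeff_pair_chain a0 mul0r.
by exists n; rewrite ZE AE (zmod_morphismMz _ (pair_chainBl _ _)).
Qed.

Lemma tight_pair_0cell k t (e : (0 + t.+1 == k.+1)%N) c c' :
  tight_cell (S := cubic_product S S') (pair_cell e c c').
Proof.
pose e0 : (0 + t == k)%N := e.
apply: (tight_product_cell (T := pair_chain e0 << c >> (cell_bd c'))).
- by rewrite cell_bdE pbd_pair_0chain.
- by move=> /pair_chain_eq0r; case: (tS'.2 _ c').
move=> Z cycZ suppZ.
have [B coefB] : exists B : {freeg (cell S' t) / int},
    forall b, coeff b B = coeff (pair_cell e0 c b) Z.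
  apply: (freeg_fiber (r := dom (cell_bd c' : {freeg (cell S' t) / int}))) => b.
  by move=> /coeff_outdom b0; apply: suppZ; rewrite coeff_pair_chain b0 mulr0.
have ZE : Z = pair_chain e0 << c >> B.
  apply: coeff_inj => x; have [[a [b ->]]|x0] := pcell_dimP e0 x; last first.
    by rewrite suppZ !x0.
  rewrite coeff_pair_chain coefB coeffU mul1r.
  have [->|/negPf ne] := eqVneq c a; first by rewrite mul1r.
  by rewrite mul0r suppZ // coeff_pair_chain coeffU ne !(mulr0, mul0r).
have [||n BE] := tight_cell_gen (A := B) (tS'.2 _ c').
- by apply: (closed_pair_0chain (e := e0) (c := c)); rewrite -ZE.
- by move=> b b0; rewrite coefB suppZ // coeff_pair_chain b0 mulr0.
by exists n; rewrite ZE BE (zmod_morphismMz _ (pair_chainBr _ _)).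
Qed.

Lemma tight_pair_cell k s t (e : (s.+1 + t.+1 == k.+2)%N) c c' :
  tight_cell (S := cubic_product S S') (pair_cell e c c').
Proof.
pose el : (s + t.+1 == k.+1)%N := e.
pose er : (s.+1 + t == k.+1)%N := addnS_eq e.
pose dc : {freeg (cell S s) / int} := cell_bd c.
pose dc' : {freeg (cell S' t) / int} := cell_bd c'.
have ne_ss : s != s.+1 by rewrite neq_ltn ltnSn.
have ne_Ss : s.+1 != s by rewrite eq_sym.
apply: (tight_product_cell
  (T := pair_chain el dc << c' >> + (-1) ^+ s.+1 *: pair_chain er << c >> dc')).
- by rewrite cell_bdE pbd_pair_chain.
- have /neq0_coeff [a] : dc <> 0 by case: (tS.2 _ c).
  (* The two summands lie in different blocks, so no cancellation can occur at (a, c'). *)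
  move=> /eqP a0 /(congr1 (coeff (pair_cell el a c'))).
  rewrite coeffD coeffZ coeff_pair_chain coeff_pair_chain_neq //.
  by rewrite mulr0 addr0 coeffU eqxx !mulr1 coeff0 => /a0.
move=> Z cycZ suppZ.
have suppl a b : coeff a dc * coeff b << c' >> = 0 ->
    coeff (pair_cell el a b) Z = 0.
  move=> ab0; apply: suppZ; rewrite coeffD coeffZ coeff_pair_chain ab0.
  by rewrite coeff_pair_chain_neq // mulr0 addr0.
have suppr a b : coeff a << c >> * coeff b dc' = 0 ->
    coeff (pair_cell er a b) Z = 0.
  move=> ab0; apply: suppZ; rewrite coeffD coeffZ coeff_pair_chain ab0.
  by rewrite coeff_pair_chain_neq // mulr0 addr0.
have [A coefA] : exists A : {freeg (cell S s) / int},
    forall a, coeff a A = coeff (pair_cell el a c') Z.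
  apply: (freeg_fiber (r := dom dc)) => a.
  by move=> /coeff_outdom a0; apply: suppl; rewrite a0 mul0r.
have [B coefB] : exists B : {freeg (cell S' t) / int},
    forall b, coeff b B = coeff (pair_cell er c b) Z.
  apply: (freeg_fiber (r := dom dc')) => b.
  by move=> /coeff_outdom b0; apply: suppr; rewrite b0 mulr0.
have ZE : Z = pair_chain el A << c' >> + pair_chain er << c >> B.
  apply: coeff_inj => x; rewrite coeffD.
  have [[a [b ->]]|x0] := pcell_dimP el x.
    rewrite coeff_pair_chain coeff_pair_chain_neq // addr0 coefA coeffU mul1r.
    have [->|/negPf ne] := eqVneq c' b; first by rewrite mulr1.
    by rewrite mulr0 suppl // coeffU ne !mulr0.
  have [[a [b ->]]|x1] := pcell_dimP er x.
    rewrite coeff_pair_chain coeff_pair_chain_neq // add0r coefB coeffU mul1r.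
    have [->|/negPf ne] := eqVneq c a; first by rewrite mul1r.
    by rewrite mul0r suppr // coeffU ne mulr0 mul0r.
  by rewrite suppZ ?coeffD ?coeffZ ?x0 ?x1 ?mulr0 ?addr0.
have e0 : (s + t == k)%N by rewrite -eqSS -addnS.
(* The (a, b) entry of dZ = 0 in block (s, t), where both summands of Z contribute. *)
have AB a b : (-1) ^+ s * (coeff a A * coeff b dc')
    + coeff a dc * coeff b B = 0.
  have := congr1 (coeff (pair_cell e0 a b)) cycZ.
  rewrite coeff0 ZE => <-; rewrite raddfD coeffD.
  by rewrite (coeff_pbd_right (S := S)) (coeff_pbd_left (S := S)).
have dA0 : bd S s A = 0.
  have /neq0_coeff [b b0] : dc' <> 0 by case: (tS'.2 _ c').
  (* Fixing b with nonzero coefficient in dc' turns [AB] into an equation between multiples of A and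
     of the cycle dc. *)
  have mulA : A *~ ((-1) ^+ s * coeff b dc') = dc *~ (- coeff b B).
    apply: coeff_inj => a; rewrite !coeffMz mulrCA mulrN.
    by apply/eqP; rewrite -addr_eq0 AB.
  apply: (@chains_mulz_eq0 _ _ _ ((-1) ^+ s * coeff b dc')).
    by rewrite mulf_neq0 ?signr_eq0.
  by rewrite -raddfMz mulA raddfMz (tS.1 s) mul0rz.
have [|n AE] := tight_cell_gen (tS.2 _ c) dA0.
  by move=> a a0; rewrite coefA; apply: suppl; rewrite a0 mul0r.
(* The multiplier comes from putting A = n dc in [AB] and cancelling a nonzero coefficient of dc;
   the sign is that of the second term of the boundary, so n serves both blocks. *)
have BE : B = dc' *~ ((-1) ^+ s.+1 * n).
  have /neq0_coeff [a a0] : dc <> 0 by case: (tS.2 _ c).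
  apply: coeff_inj => b; apply: (mulfI a0); apply/eqP.
  rewrite coeffMz -subr_eq0 exprS mulN1r mulNr !mulrN opprK addrC.
  rewrite -[X in _ == X](AB a b) AE coeffMz; apply/eqP; congr (_ + _).
  by rewrite -/dc; ring.
exists n; rewrite ZE AE BE scale_freeg mulrzDl -mulrzA.
rewrite (zmod_morphismMz _ (pair_chainBl _ _)).
by rewrite (zmod_morphismMz _ (pair_chainBr _ _)).
Qed.

End Product.

Theorem theorem6p3p1 (S S' : chain_seq)
    (tS : tight_script S) (tS' : tight_script S')
    (pS : forall p : cell S 0, cell_bd p = 1 :> int)
    (pS' : forall p : cell S' 0, cell_bd p = 1 :> int) :
  tight_script (cubic_product S S').
Proof.
split; first exact: is_script_cubic_product.
move=> k x; have [s [t [e [c [c' ->]]]]] := pcellP x.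
case: k x e => [|k] x e.
  (* A product of points: every integer Z is Z times the accumulator. *)
  have T : cell_bd (S := cubic_product S S') (pair_cell e c c') = 1 :> int.
    exact: degU.
  split; first by rewrite T.
  move=> Z; split=> [_|[n ->]]; first by exists Z; rewrite T intz.
  exact/cycles_in_mulz/is_script_cubic_product.
case: s e c => [|s] e c; case: t e c' => [|t] e c' //.
- exact: tight_pair_0cell.
- exact: tight_pair_cell0.
(* Two cells of positive dimension have total dimension at least 2. *)
case: k x e => [|k] x e; first by exfalso; move: e; rewrite addSn addnS.
exact: tight_pair_cell.
Qed.
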